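(* For every metric space $X$, the major coarse dimension of $X$ does not exceed the asymptotic dimension of $X$: $\dim^{COA}_{RSE}(X)\le \mathrm{asdim}(X)$.
   Context: Let $(X,d)$ be a metric space. For points, $x_k\to\infty$ means $d(x_k,x_0)\to\infty$ for some (hence every) $x_0\in X$. A function $f:X\to[0,\infty]$ is coarsely proper if $f(x_k)\to\infty$ whenever $x_k\to\infty$. Families of subsets of $X$ need not cover $X$. For a family $\mathcal U$ of subsets of $X$, the local Lebesgue number at $x$ is $L_{\mathcal U}(x)=\sup_{U\in\mathcal U}\mathrm{dist}(x,X\setminus U)\in[0,\infty]$, with $\mathrm{dist}(x,\emptyset)=\infty$ and the supremum over the empty family equal to $0$. For $A\subset X$, $L(\mathcal U,A)=\inf_{x\in A}L_{\mathcal U}(x)$; the Lebesgue number of $\mathcal U$ is $L(\mathcal U,X)$. The family $\mathcal U$ is coarse if $L_{\mathcal U}$ is coarsely proper. The multiplicity of $\mathcal U$ is the supremum over $x\in X$ of the number of elements of $\mathcal U$ containing $x$. $\mathcal V$ refines $\mathcal U$ if each element of $\mathcal V$ is contained in some element of $\mathcal U$; a coarse refinement is a refinement that is a coarse family. The major coarse dimension $\dim^{COA}_{RSE}(X)$ is the smallest integer $n\ge-1$ such that every coarse family in $X$ has a coarse refinement of multiplicity at most $n+1$ ($\infty$ if there is none). For $n\ge 0$ and a family $\mathcal U$ in $X$, $L^n(\mathcal U,X)$ is the supremum of all $t\in[0,\infty]$ such that $\mathcal U$ has a refinement of multiplicity at most $n+1$ and Lebesgue number at least $t$. The asymptotic dimension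 $\mathrm{asdim}(X)$ is the smallest integer $n\ge0$ such that $\mathcal U\mapsto L^n(\mathcal U,X)$ is coarsely proper on the covers of $X$, i.e. $L^n(\mathcal U_k,X)\to\infty$ for every sequence of covers $\mathcal U_k$ of $X$ with $L(\mathcal U_k,X)\to\infty$ ($\infty$ if there is no such $n$). *)

(* Defs.v *)
From HB Require Import structures.
From mathcomp Require Import all_boot all_order all_algebra.
From mathcomp Require Import all_classical all_reals all_analysis.

Set Implicit Arguments.
Unset Strict Implicit.
Unset Printing Implicit Defensive.

Import Order.TTheory GRing.Theory Num.Theory.
Import numFieldNormedType.Exports.

Local Open Scope classical_set_scope.
Local Open Scope ring_scope.
Local Open Scope ereal_scope.

Section coarse_dimension.
Context {R : realType} {X : metricType R}.
Implicit Types (x : X) (A : set X) (U V : set (set X)) (f : X -> \bar R).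

Definition tends_to_infinity (x_ : nat -> X) :=
  exists x0 : X, (fun k => mdist (x_ k) x0) @ \oo --> +oo%R.

Definition coarsely_proper f :=
  forall x_ : nat -> X, tends_to_infinity x_ -> (fun k => f (x_ k)) @ \oo --> +oo.

(* ereal_inf set0 = +oo, hence dist x set0 = +oo *)
Definition dist x A : \bar R := ereal_inf [set (mdist x y)%:E | y in A].

(* Suprema of values in [0, +oo]: since ereal_sup set0 = -oo, the value 0 is
   added so that the empty supremum is 0. *)
Definition nnsup (S : set (\bar R)) : \bar R := ereal_sup (0 |` S).

Definition local_lebesgue_number U x : \bar R :=
  nnsup [set dist x (~` W) | W in U].

Definition lebesgue_number U A : \bar R :=
  ereal_inf [set local_lebesgue_number U x | x in A].

Definition coarse_family U := coarsely_proper (local_lebesgue_number U).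

Definition multiplicity U : \bar R :=
  nnsup [set counting [set W | U W /\ W x] | x in [set: X]].

Definition refines V U := forall W, V W -> exists2 W', U W' & W `<=` W'.

Definition coarse_refinement V U := refines V U /\ coarse_family V.

Definition is_cover U := \bigcup_(W in U) W = [set: X].

(* L^n(U, X) *)
Definition refined_lebesgue_number (n : nat) U : \bar R :=
  nnsup [set t | 0 <= t /\
    exists V, [/\ refines V U, multiplicity V <= n.+1%:R%:E
                & t <= lebesgue_number V [set: X]]].

End coarse_dimension.

(* Both dimensions below are infima in \bar R of sets of integers bounded below:
   such an infimum is the least element if the set is nonempty, and +oo
   otherwise. *)

Definition major_coarse_dimension {R : realType} (X : metricType R) : \bar R :=
  ereal_inf [set (n%:~R : R)%:E | n in [set n : int | (-1 <= n)%R /\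
    forall U : set (set X), coarse_family U ->
      exists2 V, coarse_refinement V U & multiplicity V <= ((n + 1)%:~R)%:E]].

Definition asdim {R : realType} (X : metricType R) : \bar R :=
  ereal_inf [set (n%:R : R)%:E | n in [set n : nat |
    forall U_ : nat -> set (set X), (forall k, is_cover (U_ k)) ->
      (fun k => lebesgue_number (U_ k) [set: X]) @ \oo --> +oo ->
      (fun k => refined_lebesgue_number n (U_ k)) @ \oo --> +oo]].

(* Main.v *)
Require Import Defs.
From mathcomp Require Import all_boot all_order all_algebra.
From mathcomp Require Import all_classical all_reals all_analysis.
From mathcomp Require Import finmap lra.

(** Why the theorem is true.  Let [n] satisfy the condition defining [asdim X],
    and let [U] be a coarse family.  By [asdim_uniform], [X] has uniformly
    bounded covers of multiplicity at most [n + 1] and arbitrarily large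
    Lebesgue number.  Iterating ([cover_sequence]) gives such covers
    [V 0], [V 1], ..., each refining the next, with Lebesgue numbers tending to
    infinity.  Take balls [B 0], [B 1], ... around a base point whose radii grow
    so fast that, beyond [B j], [U] has elements containing balls much
    larger than the elements of the first few covers after [V j].  The wanted
    refinement of [U] looks like [V j] in the [j]-th annulus, so the only issue
    is to pass from [V j] to [V j.+1] across the boundary of [B j] without
    increasing the multiplicity.

    This is the operation [merge F B V], for a family [F] refining [V]: the
    elements of [F] contained in [B] are kept; each remaining element [W] of [F]
    is absorbed into one element of [V] containing it, its parent; and from an
    element of [V] the points of [B] are removed, except those regained by
    absorption.  At a point of [B] every set of the merged family comes from a
    set of [F] through that point, and at a point outside [B] from a set of [V]
    through that point, so the multiplicity does not increase
    ([merge_multiplicity]).  Since [F] refines the merged family, no Lebesgue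
    number is lost near the boundary.

    Merging successively, [F j.+1 := merge (F j) (B j) (V j.+1)], the sets of
    [F j] contained in [B j] are never modified again.  They form an increasing
    sequence of families of multiplicity at most [n + 1], hence so does their
    union, and those of them that lie in an element of [U] form the wanted
    coarse refinement ([coarse_refinement_exists]). *)

Set Implicit Arguments.
Unset Strict Implicit.
Unset Printing Implicit Defensive.

Import Order.TTheory GRing.Theory Num.Theory.

Local Open Scope classical_set_scope.
Local Open Scope card_scope.
Local Open Scope ring_scope.

(** * Cardinality of increasing unions *)

Lemma card_le_fset_subP (T : choiceType) (A : set T) (m : nat) :
  (forall B : {fset T}, [set` B] `<=` A -> (#|` B| <= m)%N) -> A #<= `I_m.
Proof.
move=> Am; have finA : finite_set A.
  apply: contrapT => /(infinite_set_fset m.+1)[B /Am].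
  by move=> /leq_ltn_trans /[apply]; rewrite ltnn.
have cA : (#|` fset_set A| <= m)%N by apply: Am; rewrite fset_setK.
have /finite_setP[k Ak] := finA.
by rewrite (card_le_eql Ak) card_le_II -(card_fset_set Ak).
Qed.

(** A finite part of the union already lies in one of the sets. *)
Lemma card_le_bigcup_chain (T : choiceType) (A : nat -> set T) (m : nat) :
  {homo A : i j / (i <= j)%N >-> i `<=` j} -> (forall i, A i #<= `I_m) ->
  \bigcup_i A i #<= `I_m.
Proof.
move=> ndA cA; apply: card_le_fset_subP => B BA.
have /choice[n nP] : forall x, exists i, x \in B -> A i x.
  move=> x; have [xB|] := boolP (x \in B); last by exists 0%N.
  by have [i _ Aix] := BA x xB; exists i.
pose N := (\max_(x <- B) n x)%N.
have BN : [set` B] `<=` A N.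
  move=> x xB; apply: (ndA (n x)); last exact: nP.
  exact: (@leq_bigmax_seq _ _ predT).
have /geq_card_fset_set := card_le_trans (subset_card_le BN) (cA N).
by rewrite set_fsetK.
Qed.

Section coarse_covers.
Context {R : realType} {X : metricType R}.
Implicit Types (x y : X) (W B : set X) (U V F : set (set X)) (r : R).

(** * Lebesgue numbers and multiplicity in terms of balls and points *)

Definition cball x r : set X := [set y | mdist x y <= r].

Lemma le_dist_setC x W r : cball x r `<=` W -> (r%:E <= dist x (~` W))%E.
Proof.
move=> xW; apply: le_ereal_inf_tmp => _ [y /= Wy <-].
by rewrite lee_fin leNgt; apply/negP => /ltW /xW.
Qed.

Lemma cball_sub_dist x W r : (r%:E < dist x (~` W))%E -> cball x r `<=` W.
Proof.
move=> rW y /= xy; apply: contrapT => Wy.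
have : (dist x (~` W) <= (mdist x y)%:E)%E by apply: ereal_inf_lbound; exists y.
by move=> /(lt_le_trans rW); rewrite lte_fin ltNge xy.
Qed.

Lemma le_local_lebesgue_number V W x r :
  V W -> cball x r `<=` W -> (r%:E <= local_lebesgue_number V x)%E.
Proof.
move=> VW /le_dist_setC /le_trans; apply; apply: ereal_sup_ubound.
by right; exists W.
Qed.

Lemma lt_local_lebesgue_number V x r : 0 <= r ->
  (r%:E < local_lebesgue_number V x)%E -> exists2 W, V W & cball x r `<=` W.
Proof.
move=> r0 /ereal_sup_gt[_ [->|[W VW <-]]]; first by rewrite lte_fin ltNge r0.
by move=> /cball_sub_dist; exists W.
Qed.

Definition mult_le (m : nat) V := forall x, [set W | V W /\ W x] #<= `I_m.

Lemma multiplicity_leP V m :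
  (multiplicity V <= (m%:R : R)%:E)%E <-> mult_le m V.
Proof.
split=> [Vm x|Vm].
  have : (counting [set W | V W /\ W x] <= (m%:R : R)%:E)%E.
    by apply: le_trans Vm; apply: ereal_sup_ubound; right; exists x.
  rewrite /counting; case: ifPn => // /asboolP finA.
  rewrite lee_fin ler_nat; have /finite_setP[k Ak] := finA.
  by rewrite (card_fset_set Ak) (card_le_eql Ak) card_le_II.
apply: ge_ereal_sup => _ [->|[x _ <-]]; first by rewrite lee_fin.
rewrite /counting ifT ?lee_fin ?ler_nat; first exact: geq_card_fset_set.
by apply/asboolP/finite_set_leP; exists m.
Qed.

(** The sequential definition of coarse properness as a uniform one: points
    [x_ k] at distance at least [k] from the base point that violate it for a
    fixed [r] would form a sequence tending to infinity along which the local
    Lebesgue number stays bounded. *)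
Lemma coarse_familyP x0 V : coarse_family V <->
  forall r, exists s, forall x, s <= mdist x0 x ->
    exists2 W, V W & cball x r `<=` W.
Proof.
split=> [cV r|cV x_ [x1 x_oo]].
  apply: contrapT => nV.
  have /choice[x_ xP] (k : nat) : exists x, k%:R <= mdist x0 x /\
      ~ exists2 W, V W & cball x r `<=` W.
    apply: contrapT => nx; apply: nV; exists k%:R => x kx.
    by apply: contrapT => nW; apply: nx; exists x.
  (* The lower bound 0 excludes the conventional value of an empty supremum. *)
  have /cvgeyPgt/(_ (Num.max r 0)) :
      (fun k => local_lebesgue_number V (x_ k)) @ \oo --> +oo%E.
    apply: cV; exists x0; apply/cvgryPge => A; near=> k.
    rewrite metric_sym (le_trans _ (xP k).1)//; near: k.
    exact: nbhs_infty_ger.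
  case=> k _ /(_ k (leqnn k)) /lt_local_lebesgue_number.
  rewrite le_max lexx orbT => /(_ isT)[W VW xW].
  apply: (xP k).2; exists W => // y /= xy; apply: xW.
  by rewrite /cball /= le_max xy.
apply/cvgeyPge => A; have [s sP] := cV A.
move/cvgryPge/(_ (s + mdist x0 x1)) : x_oo; apply: filterS => k /= sk.
have [|W VW xW] := sP (x_ k); last exact: le_local_lebesgue_number VW xW.
have := metric_triangle (x_ k) x0 x1.
by rewrite (metric_sym (x_ k) x0); lra.
Unshelve. all: by end_near. Qed.

(** * Uniformly bounded covers *)

(** Only the covers by balls of radius [k] are fed into the condition defining
    [asdim]: their Lebesgue numbers tend to infinity, and a refinement of such a
    cover has elements of diameter at most [2 k]. *)
Lemma asdim_uniform n :
  (forall U_ : nat -> set (set X), (forall k, is_cover (U_ k)) ->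
    (fun k => lebesgue_number (U_ k) [set: X]) @ \oo --> +oo%E ->
    (fun k => refined_lebesgue_number n (U_ k)) @ \oo --> +oo%E) ->
  forall r, 0 <= r -> exists D : R, exists V,
   [/\ mult_le n.+1 V,
       forall W x y, V W -> W x -> W y -> mdist x y <= D
     & forall x, exists2 W, V W & cball x r `<=` W].
Proof.
move=> asn r r0.
pose U_ k : set (set X) := range (fun x => cball x k%:R).
(* The margin 1 leaves room to turn the non-strict bound on the Lebesgue number
   of the refinement into a strict one, as lt_local_lebesgue_number wants. *)
have /cvgeyPgt/(_ (r + 1)) :
    (fun k => refined_lebesgue_number n (U_ k)) @ \oo --> +oo%E.
  apply: asn => [k|].
    rewrite /is_cover -subTset => x _; exists (cball x k%:R); first by exists x.
    by rewrite /cball /= mdistxx.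
  apply/cvgeyPge => A; near=> k.
  apply: le_ereal_inf_tmp => _ [x _ <-].
  rewrite (@le_trans _ _ k%:R%:E)//.
    by rewrite lee_fin; near: k; exact: nbhs_infty_ger.
  by apply: (@le_local_lebesgue_number _ (cball x k%:R)) => //; exists x.
case=> k _ /(_ k (leqnn k)) /ereal_sup_gt[t [->|[_ [V [VU Vn tV]]]]].
  by rewrite lte_fin; lra.
move=> rt; exists (k%:R *+ 2), V; split.
- exact/multiplicity_leP.
- move=> W x y /VU[_ [z _ <-]] WU /WU /= xz /WU /= yz.
  by rewrite mulr2n (le_trans (metric_triangle x z y))// lerD// metric_sym.
- move=> x; apply: lt_local_lebesgue_number => //.
  apply: (@lt_le_trans _ _ (r + 1)%:E); first by rewrite lte_fin; lra.
  apply: le_trans (ltW rt) (le_trans tV _).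
  by apply: ereal_inf_lbound; exists x.
Unshelve. all: by end_near. Qed.

(** Choosing the Lebesgue number of each cover to exceed the diameters of the
    elements of the previous one makes the covers refine each other. The single
    scale [M i.+1] then bounds both the diameters in [V i] and, from below, the
    Lebesgue number of [V i.+1]. The base point ensures that the next cover is
    nonempty, as is needed when the empty set belongs to a cover. *)
Lemma cover_sequence x0 m :
  (forall r, 0 <= r -> exists D : R, exists V,
   [/\ mult_le m V,
       forall W x y, V W -> W x -> W y -> mdist x y <= D
     & forall x, exists2 W, V W & cball x r `<=` W]) ->
  exists (M : nat -> R) (V : nat -> set (set X)),
   [/\ forall i, i%:R <= M i, {homo M : i j / (i <= j)%N >-> i <= j},
       forall i, mult_le m (V i) /\ refines (V i) (V i.+1),
       forall i W x y, V i W -> W x -> W y -> mdist x y <= M i.+1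
     & forall i x, exists2 W, V i W & cball x (M i) `<=` W].
Proof.
move=> hV.
have {hV}/choice[DV DVP] r : exists DV : R * set (set X), 0 <= r ->
   [/\ mult_le m DV.2,
       forall W x y, DV.2 W -> W x -> W y -> mdist x y <= DV.1
     & forall x, exists2 W, DV.2 W & cball x r `<=` W].
  have [/hV[D [V DV]]|] := boolP (0 <= r); first by exists (D, V).
  by exists (0, set0).
pose M := fix M i : R :=
  if i is j.+1 then M j + 1 + Num.max 0 (DV (M j)).1 else 0.
have max0 i : 0 <= Num.max 0 (DV (M i)).1 by rewrite le_max lexx.
have iM i : i%:R <= M i.
  by elim: i => //= i Mi; rewrite -natr1; have := max0 i; lra.
have M0 i : 0 <= M i by apply: le_trans (iM i).
pose V i := (DV (M i)).2.
have VD i W x y : V i W -> W x -> W y -> mdist x y <= M i.+1.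
  have [_ + _] := DVP _ (M0 i) => /[apply]/[apply]/[apply] /=.
  move=> xy; apply: (le_trans xy); rewrite -[leLHS]add0r lerD//.
    by have := M0 i; lra.
  by rewrite le_max lexx orbT.
have VL i x : exists2 W, V i W & cball x (M i) `<=` W.
  by have [_ _ +] := DVP _ (M0 i); exact.
exists M, V; split=> //.
- apply: homo_leq => //= [? ? ?|i]; first exact: le_trans.
  by have := max0 i; lra.
- move=> i; split; first by have [] := DVP _ (M0 i).
  move=> W VW; have [->|/set0P[x Wx]] := eqVneq W set0.
    by have [W' ? _] := VL i.+1 x0; exists W'.
  have [W' VW' xW'] := VL i.+1 x; exists W' => // y Wy; apply: xW'.
  exact: VD VW Wx Wy.
Qed.

(** * Merging a cover into a coarser one outside a set *)

Lemma refines_trans V1 V2 V3 : refines V1 V2 -> refines V2 V3 -> refines V1 V3.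
Proof.
move=> V12 V23 W /V12[W' /V23[W'' VW'' W'W''] WW']; exists W'' => //.
exact: subset_trans W'W''.
Qed.

Definition parent V W : set X := xget set0 [set W' | V W' /\ W `<=` W'].

Lemma parentP F V W : refines F V -> F W -> V (parent V W) /\ W `<=` parent V W.
Proof.
move=> FV /FV[W' VW' WW'].
by apply: (@xgetPex _ set0 [set W' | V W' /\ W `<=` W']); exists W'.
Qed.

Definition absorb F B V W' : set X :=
  (W' `\` B) `|`
  \bigcup_(W in [set W | [/\ F W, ~ W `<=` B & parent V W = W']]) W.

Definition merge F B V : set (set X) :=
  [set W | F W /\ W `<=` B] `|` (absorb F B V @` V).

Lemma absorb_sub F B V W' : refines F V -> absorb F B V W' `<=` W'.
Proof.
move=> FV x [[]//|[W [FW _ <-] Wx]].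
by have [_] := parentP FV FW; apply.
Qed.

Lemma refines_merge F B V : refines F V -> refines F (merge F B V).
Proof.
move=> FV W FW; have [WB|WB] := pselect (W `<=` B); first by exists W => //; left.
exists (absorb F B V (parent V W)); last by move=> x Wx; right; exists W.
by right; exists (parent V W) => //; have [] := parentP FV FW.
Qed.

Lemma merge_refines F B V : refines F V -> refines (merge F B V) V.
Proof.
move=> FV _ [[/FV//]|[W' VW' <-]]; exists W' => //; exact: absorb_sub.
Qed.

(** Inside [B], sending an element of [F] to itself if it is kept and to the set
    absorbing it otherwise maps the elements of [F] through a point onto those of
    the merged family: each element of [F] is used only once, having only one
    parent. Outside [B] no element is kept, and [absorb] does the same with the
    elements of [V]. *)
Lemma merge_multiplicity F B V m :
  refines F V -> mult_le m F -> mult_le m V -> mult_le m (merge F B V).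
Proof.
move=> FV Fm Vm x; have [Bx|Bx] := pselect (B x).
- pose f W := if pselect (W `<=` B) then W else absorb F B V (parent V W).
  apply: card_le_trans (card_le_trans (card_image_le f _) (Fm x)).
  apply: subset_card_le => W1 [[[FW WB]|[W' VW' <-]]].
    by move=> Wx; exists W1 => //; rewrite /f; case: pselect.
  move=> [[]//|[W [FW WB WW'] Wx]]; exists W => //.
  by rewrite /f; case: (pselect (W `<=` B)) => [/WB//|nWB] /=; rewrite WW'.
- apply: card_le_trans (card_le_trans (card_image_le (absorb F B V) _) (Vm x)).
  apply: subset_card_le => W1 [[[FW WB]|[W' VW' <-]]] W'x.
    by case: Bx; apply: WB.
  by exists W' => //; split=> //; exact: absorb_sub W'x.
Qed.

(** * Gluing the covers along the annuli *)

(** The radii [r] grow fast enough that a set of diameter at most [M i.+2]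
    meeting the ball [B i] lies in [B i.+1], and that beyond [B i.+1] the family
    [U] has elements containing balls of radius [M i.+4]. *)
Lemma coarse_refinement_exists x0 m U :
  (forall r, 0 <= r -> exists D : R, exists V,
   [/\ mult_le m V,
       forall W x y, V W -> W x -> W y -> mdist x y <= D
     & forall x, exists2 W, V W & cball x r `<=` W]) ->
  coarse_family U ->
  exists2 V, coarse_refinement V U & mult_le m V.
Proof.
move=> /(cover_sequence x0)[M [V [iM leM VmV VD VL]]].
move=> /(coarse_familyP x0) /choice[rho rhoP].
pose r := fix r i : R :=
  if i is j.+1 then Num.max (r j + M j.+2) (rho (M j.+4)) else 0.
have rM i : r i + M i.+2 <= r i.+1 by rewrite /= le_max lexx.
have rrho i : rho (M i.+4) <= r i.+1 by rewrite /= le_max lexx orbT.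
have ler : {homo r : i j / (i <= j)%N >-> i <= j}.
  apply: homo_leq => // [? ? ?|i]; first exact: le_trans.
  by have := rM i; have := le_trans (ler0n R _) (iM i.+2); lra.
have ir i : i%:R <= r i.
  elim: i => // i IH; have := rM i; have := iM i.+2; rewrite -!natr1.
  have : 0 <= i%:R :> R by [].
  by lra.
clearbody r.
pose B i := cball x0 (r i).
have leB : {homo B : i j / (i <= j)%N >-> i `<=` j}.
  by move=> i j /ler ij x; rewrite /B /cball/= => /le_trans; apply.
pose F := fix F i := if i is j.+1 then merge (F j) (B j) (V j.+1) else V 0%N.
have FV i : refines (F i) (V i).
  elim: i => [W VW|i FV]; first by exists W.
  by apply: merge_refines; exact: refines_trans FV (VmV i).2.
have FV1 i : refines (F i) (V i.+1) := refines_trans (FV i) (VmV i).2.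
have Fm i : mult_le m (F i).
  elim: i => [|i IH]; first exact: (VmV 0%N).1.
  by apply: merge_multiplicity => //; exact: (VmV i.+1).1.
have FF i : refines (F i) (F i.+1) by apply: refines_merge.
pose K i := [set W | F i W /\ W `<=` B i].
have leK : {homo K : i j / (i <= j)%N >-> i `<=` j}.
  apply: homo_leq => [?|? ? ?|i W [FW WB]];
    [exact: subset_refl|exact: subset_trans|].
  by split; [left|apply: subset_trans WB _; exact: leB].
pose G := [set W | (\bigcup_i K i) W /\ exists2 W', U W' & W `<=` W'].
have GU : refines G U by move=> W [].
exists G; last first.
  move=> x; have /card_le_bigcup_chain : {homo
      (fun i => [set W | K i W /\ W x]) : i j / (i <= j)%N >-> i `<=` j}.
    by move=> i j /leK ij W [/ij].
  move=> /(_ m) cK; apply: card_le_trans (cK _); last first.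
    by move=> i; apply: card_le_trans (Fm i x); apply: subset_card_le => W [[]].
  by apply: subset_card_le => W [[[i _ KW] _] Wx]; exists i.
split=> //; apply/(coarse_familyP x0) => s.
have [N sN] : exists N, s <= N%:R.
  exists (Num.bound `|s|).
  by rewrite ltW// (le_lt_trans (ler_norm s))// archi_boundP.
exists (r N.+1 + 1) => x Nx.
have [j [Nj jx xj]] : exists j,
    [/\ (N <= j)%N, r j.+1 < mdist x0 x & mdist x0 x <= r j.+2].
  have ex : exists k, mdist x0 x <= r k.
    exists (Num.bound (mdist x0 x)); apply: le_trans (ir _).
    by rewrite ltW// archi_boundP// mdist_ge0.
  case: (ex_minnP ex) => k xk kmin.
  have Nk : (N.+1 < k)%N.
    by rewrite ltnNge; apply/negP => /ler; move: Nx xk; lra.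
  case: k Nk xk kmin => [|[|j]]// Nj xj kmin; exists j; split=> //.
  by rewrite ltNge; apply/negP => /kmin; rewrite ltnn.
(* A point x between B j.+1 and B j.+2 is far from B j, so that the merged family
   F j.+1 contains near x the whole of an element of V j.+1. *)
have [W0 VW0 xW0] := VL j.+1 x.
have FW1 : F j.+1 (absorb (F j) (B j) (V j.+1) W0) by right; exists W0.
have xW1 : cball x (M j.+1) `<=` absorb (F j) (B j) (V j.+1) W0.
  move=> y xy; left; split; first exact: xW0.
  move: xy; rewrite /B /cball /= => xy yB.
  have := metric_triangle x0 y x; rewrite (metric_sym y x).
  have := rM j; have := leM _ _ (leqnSn j.+1).
  by lra.
(* Two more merges enlarge this set to one that meets B j.+2 and belongs to
   F j.+3, hence lies in B j.+3 and is kept from then on. *)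
have [W2 FW2 W12] := FF _ _ FW1.
have [W FW W23] := FF _ _ FW2.
have xW : cball x (M j.+1) `<=` W.
  exact: subset_trans (subset_trans xW1 W12) W23.
have Wx : W x.
  by apply: xW; rewrite /cball /= mdistxx; exact: le_trans (iM j.+1).
have WD : W `<=` cball x (M j.+4).
  have [W' VW' WW'] := FV _ _ FW.
  by move=> y /WW' W'y; apply: VD VW' (WW' _ Wx) W'y.
exists W; last first.
  apply: subset_trans xW => y xy.
  rewrite /cball /= (le_trans xy)// (le_trans sN)//.
  by apply: le_trans (iM _); rewrite ler_nat (leq_trans Nj).
split.
  exists j.+3 => //; split=> // y /WD; rewrite /B /cball /= => xy.
  by have := metric_triangle x0 x y; have := rM j.+2; lra.
have [|W' UW' xW'] := rhoP (M j.+4) x; first by have := rrho j; lra.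
by exists W' => //; exact: subset_trans xW'.
Qed.

End coarse_covers.

(** * The inequality between the dimensions *)

(** Every [n] admissible for [asdim X] is admissible for the major coarse
    dimension. The empty space has no base point, but every family in it is
    coarse, there being no sequences of points. *)
Theorem theorem5p10 (R : realType) (X : metricType R) :
  (major_coarse_dimension X <= asdim X)%E.
Proof.
apply: le_ereal_inf_tmp => _ [n asn <-].
apply: ereal_inf_lbound; exists n%:Z => //; split=> [|U cU].
  by rewrite (le_trans (y := 0)).
have -> : (n%:Z + 1)%:~R = n.+1%:R :> R by rewrite intrD natr1.
have [[x0 _]|X0] := pselect ([set: X] !=set0).
  have [V VU Vm] := coarse_refinement_exists x0 (asdim_uniform asn) cU.
  by exists V => //; apply/multiplicity_leP.
exists set0.
  by split=> // x_ _; exfalso; apply: X0; exists (x_ 0%N).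
by apply/multiplicity_leP => x; exfalso; apply: X0; exists x.
Qed.
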